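(* Let $q,r$ be real piecewise continuous functions on $[a,b]$ such that the Dirichlet problem $-y''+q(x)y=\lambda r(x)y$, $y(a)=y(b)=0$ is non-definite, and let $y=\varphi+i\psi$ ($\varphi={\rm Re}\,y$, $\psi={\rm Im}\,y$) be a complex ghost belonging to a non-real eigenvalue $\lambda$ with ${\rm Im}\,\lambda>0$. Put $G(x)=\int_a^x r|y|^2\,dt$ and suppose $G(x)<0$ for all $x\in(a,b)$. Suppose $\varphi'(a)>0$ (resp. $\varphi'(a)<0$) and that $\varphi$ has a zero in $(a,b)$; let $x_0\in(a,b)$ be the smallest zero of $\varphi$ in $(a,b)$. (1) If $\psi'(a)>0$, then $\psi(x)>0$ in $(a,x_0]$ (resp. if $\psi'(a)<0$, then $\psi(x)<0$ in $(a,x_0]$). (2) If $\psi'(a)<0$, then $\psi$ vanishes exactly once in $(a,x_0)$ (resp. if $\psi'(a)>0$, then $\psi$ vanishes exactly once in $(a,x_0)$). (3) If $\psi'(a)=0$, then the conclusion of one of the first two cases must occur, i.e. either $\psi>0$ in $(a,x_0]$ (resp. $\psi<0$ in $(a,x_0]$), or $\psi$ vanishes exactly once in $(a,x_0)$.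
   Context: The problem is called non-definite if each of the quadratic forms $y\mapsto\int_a^b(|y'|^2+q|y|^2)\,dx$ and $y\mapsto\int_a^b r|y|^2\,dx$ takes both positive and negative values on the domain of the Dirichlet problem. Solutions are $C^1$ functions with absolutely continuous derivative satisfying the equation almost everywhere. A complex ghost is a non-trivial eigenfunction belonging to a non-real eigenvalue. In the claim, the ''resp.'' alternatives refer to the hypothesis $\varphi'(a)<0$. *)

(* Defs.v *)
From HB Require Import structures.
From mathcomp Require Import all_boot all_order all_algebra.
From mathcomp Require Import all_classical all_reals all_analysis.
From mathcomp Require Import complex.

Set Implicit Arguments.
Unset Strict Implicit.
Unset Printing Implicit Defensive.

Import Order.TTheory GRing.Theory Num.Theory.
Import numFieldNormedType.Exports.

Local Open Scope classical_set_scope.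
Local Open Scope ring_scope.

(* The values of all functions outside [a, b] are irrelevant: the derivative
   at a point of [a, b] is taken relative to [a, b], hence is one-sided at the
   end points. *)
Definition diff_quot (R : realType) (f : R -> R) (x t : R) : R :=
  (f t - f x) / (t - x).

Definition derivable_in (R : realType) (a b : R) (f : R -> R) (x : R) : Prop :=
  cvg (diff_quot f x @ within `[a, b]%classic x^').

(* meaningful only when [derivable_in a b f x] *)
Definition deriv_in (R : realType) (a b : R) (f : R -> R) (x : R) : R :=
  lim (diff_quot f x @ within `[a, b]%classic x^').

Definition abs_continuous (R : realType) (a b : R) (f : R -> R) : Prop :=
  forall e : R, 0 < e -> exists2 d : R, 0 < d &
    forall (n : nat) (u v : 'I_n -> R),
      (forall i, [/\ a <= u i, u i <= v i & v i <= b]) ->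
      trivIset [set: 'I_n] (fun i => `]u i, v i[%classic) ->
      \sum_(i < n) (v i - u i) < d ->
      \sum_(i < n) `|f (v i) - f (u i)| < e.

(* The values of f at the finitely many exceptional points are arbitrary. *)
Definition piecewise_continuous (R : realType) (a b : R) (f : R -> R) : Prop :=
  exists s : seq R,
    [/\ forall x, x \in `]a, b[ -> x \notin s -> {for x, continuous f},
        forall x, x \in `[a, b[ -> cvg (f @ x^'+) &
        forall x, x \in `]a, b] -> cvg (f @ x^'-)].

Definition re_part (R : realType) (y : R -> R[i]) (x : R) : R :=
  complex.Re (y x).
Definition im_part (R : realType) (y : R -> R[i]) (x : R) : R :=
  complex.Im (y x).

Definition sqmod (R : realType) (z : R[i]) : R := ComplexField.Normc.normc z ^+ 2.

Definition cderivable_in (R : realType) (a b : R) (y : R -> R[i]) (x : R) :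
    Prop :=
  derivable_in a b (re_part y) x /\ derivable_in a b (im_part y) x.

Definition cderiv_in (R : realType) (a b : R) (y : R -> R[i]) (x : R) : R[i] :=
  Complex (deriv_in a b (re_part y) x) (deriv_in a b (im_part y) x).

(* C^1 functions on [a, b] with absolutely continuous derivative; continuity of
   the derivative is part of its absolute continuity. *)
Definition C1_AC (R : realType) (a b : R) (y : R -> R[i]) : Prop :=
  [/\ forall x, x \in `[a, b] -> cderivable_in a b y x,
      abs_continuous a b (re_part (cderiv_in a b y)) &
      abs_continuous a b (im_part (cderiv_in a b y))].

Definition dirichlet_domain (R : realType) (a b : R) (y : R -> R[i]) : Prop :=
  [/\ C1_AC a b y, y a = 0 & y b = 0].

Definition energy_form (R : realType) (a b : R) (q : R -> R) (y : R -> R[i]) :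
    R :=
  \int[lebesgue_measure]_(x in `[a, b])
    (sqmod (cderiv_in a b y x) + q x * sqmod (y x)).

Definition weight_form (R : realType) (a b : R) (r : R -> R) (y : R -> R[i]) :
    R :=
  \int[lebesgue_measure]_(x in `[a, b]) (r x * sqmod (y x)).

Definition takes_both_signs (R : realType) (D : (R -> R[i]) -> Prop)
    (Q : (R -> R[i]) -> R) : Prop :=
  (exists2 y, D y & 0 < Q y) /\ (exists2 y, D y & Q y < 0).

Definition non_definite (R : realType) (a b : R) (q r : R -> R) : Prop :=
  takes_both_signs (dirichlet_domain a b) (energy_form a b q) /\
  takes_both_signs (dirichlet_domain a b) (weight_form a b r).

Definition sl_solution (R : realType) (a b : R) (q r : R -> R) (lam : R[i])
    (y : R -> R[i]) : Prop :=
  C1_AC a b y /\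
  {ae @lebesgue_measure R, forall x, x \in `[a, b] ->
     cderivable_in a b (cderiv_in a b y) x /\
     - cderiv_in a b (cderiv_in a b y) x + (q x)%:C%C * y x
       = lam * (r x)%:C%C * y x}.

Definition eigenfunction (R : realType) (a b : R) (q r : R -> R) (lam : R[i])
    (y : R -> R[i]) : Prop :=
  [/\ sl_solution a b q r lam y, y a = 0, y b = 0 &
      exists2 x, x \in `[a, b] & y x != 0].

Definition complex_ghost (R : realType) (a b : R) (q r : R -> R) (lam : R[i])
    (y : R -> R[i]) : Prop :=
  eigenfunction a b q r lam y /\ complex.Im lam != 0.

Definition smallest_zero (R : realType) (a b : R) (f : R -> R) (x0 : R) : Prop :=
  [/\ x0 \in `]a, b[, f x0 = 0 &
      forall x, x \in `]a, b[ -> f x = 0 -> x0 <= x].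

Definition vanishes_exactly_once (R : realType) (a b : R) (f : R -> R) : Prop :=
  exists! x : R, a < x < b /\ f x = 0.

(* Main.v *)
(* Let W = phi psi' - phi' psi. It vanishes at a, and the equation gives
   W' = - Im(lambda) r |y|^2 almost everywhere; since W is absolutely
   continuous, W = - Im(lambda) G > 0 on (a, b). As (psi / phi)' = W / phi^2,
   the quotient psi / phi increases strictly on (a, x0), and
   W(x0) = - phi'(x0) psi(x0) > 0 with phi'(x0) <= 0 forces psi(x0) > 0. So psi
   changes sign at most once on (a, x0], from negative to positive, and its sign
   near a decides between the alternatives. The case phi'(a) < 0 follows by
   replacing y with -y. *)
Require Import Defs.
From HB Require Import structures.
From mathcomp Require Import all_boot all_order all_algebra.
From mathcomp Require Import all_classical all_reals all_analysis.
From mathcomp Require Import complex ring lra.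

Set Implicit Arguments.
Unset Strict Implicit.
Unset Printing Implicit Defensive.

Import Order.TTheory GRing.Theory Num.Theory.
Import numFieldNormedType.Exports.

Local Open Scope classical_set_scope.
Local Open Scope ring_scope.

(** * Induction over a compact interval *)

(** Cousin's lemma in the form of an induction. With c the supremum of the t such that [P a t], the
    local hypothesis at c joins some s just below c to a point beyond c, or to b; additivity then
    forces c = b. At x only pairs with s <= x <= t are considered, as in a tagged partition. *)
Lemma itv_additive_ind (R : realType) (a b : R) (P : R -> R -> Prop) :
  a <= b ->
  (forall s t u : R, a <= s -> s <= t -> t <= u -> u <= b ->
     P s t -> P t u -> P s u) ->
  (forall x : R, a <= x <= b -> exists2 d : R, 0 < d &
     forall s t : R, a <= s <= x -> x <= t <= b -> x - d < s -> t < x + d ->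
     P s t) ->
  P a b.
Proof.
move=> ab Padd Ploc; pose S := [set t | a <= t <= b /\ P a t].
have Sa : S a.
  split; first by rewrite lexx.
  have [|d d0] := Ploc a; first by rewrite lexx.
  by apply; rewrite ?lexx ?ab//; lra.
have Sb : has_ubound S by exists b => x [/andP[]].
have hS : has_sup S by split; [exists a|].
have ac : a <= sup S by exact: ub_le_sup.
have cb : sup S <= b by apply: ge_sup; [exists a|move=> x [/andP[]]].
have [|d d0 dP] := Ploc (sup S); first by rewrite ac.
have [s Ss cs] := sup_adherent d0 hS; have [/andP[as_ sb] Pas] := Ss.
have sc : s <= sup S by exact: ub_le_sup.
(* Halving [d] keeps [t] strictly within the radius, and the minimum keeps it in [a, b]. *)
pose t := Num.min b (sup S + d / 2).
have ct : sup S <= t by rewrite /t le_min cb/=; lra.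
have tb : t <= b by rewrite /t ge_min lexx.
have Pat : P a t.
  apply: (Padd a s t) => //; first exact: le_trans ct.
  apply: dP => //; rewrite ?as_ ?ct//.
  by rewrite /t gt_min; apply/orP; right; lra.
have : t <= sup S.
  by apply: (ub_le_sup Sb); split=> //; rewrite tb (le_trans ac).
rewrite /t ge_min => /orP[bc|]; last by lra.
by move: Pat; rewrite /t min_l//; lra.
Qed.

Lemma locally_bounded_itv (R : realType) (a b : R) (f : R -> R) :
  a <= b ->
  (forall x, a <= x <= b -> exists2 d : R, 0 < d & exists M : R,
     forall t : R, a <= t <= b -> `|t - x| < d -> `|f t| <= M) ->
  exists2 M : R, 0 < M & forall t : R, a <= t <= b -> `|f t| <= M.
Proof.
move=> ab floc.
suff [M HM] : exists M : R, forall t : R, a <= t <= b -> `|f t| <= M.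
  (* The maximum with 1 makes the bound positive, fit for a divisor or a Lipschitz constant. *)
  exists (Num.max M 1); first by rewrite lt_max ltr01 orbT.
  by move=> t /HM h; rewrite le_max h.
apply: (@itv_additive_ind R a b
  (fun s t : R => exists M : R,
    forall x : R, s <= x <= t -> `|f x| <= M)) => //.
  move=> s t u as_ st tu ub [M HM] [N HN].
  exists (Num.max M N) => x /andP[sx xu].
  have [xt|tx] := leP x t; rewrite le_max; apply/orP.
    by left; apply: HM; rewrite sx.
  by right; apply: HN; rewrite ltW.
move=> x /floc[d d0 [M HM]].
exists d => // s t /andP[as_ sx] /andP[xt tb] xs tx.
exists M => z /andP[sz zt]; apply: HM; first by lra.
by rewrite ltr_norml; lra.
Qed.

(** * Absolutely continuous functions *)

Lemma abs_continuousS (R : realType) (a b c d : R) (f : R -> R) :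
  a <= c -> d <= b -> abs_continuous a b f -> abs_continuous c d f.
Proof.
move=> ac db fac e /fac[dl dl0 H]; exists dl => // n u v uv; apply: H => i.
by have [cu uvi vd] := uv i; split; lra.
Qed.

Lemma abs_continuous_unif (R : realType) (a b : R) (f : R -> R) :
  abs_continuous a b f -> forall e : R, 0 < e -> exists2 d : R, 0 < d &
    forall s t : R, a <= s <= b -> a <= t <= b -> `|t - s| < d ->
      `|f t - f s| < e.
Proof.
move=> fac e /fac[d d0 H]; exists d => //.
have {}H s t : a <= s -> s <= t -> t <= b -> t - s < d -> `|f t - f s| < e.
  (* A family of one interval turns absolute continuity into uniform continuity. *)
  move=> as_ st tb tsd; have := H 1%N (fun=> s) (fun=> t).
  rewrite !big_ord1; apply => //.
  by move=> i j _ _ _; rewrite (ord1 i) (ord1 j).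
move=> s t /andP[as_ sb] /andP[at_ tb].
have [st|ts] := leP s t; first by rewrite ger0_norm ?subr_ge0//; apply: H.
rewrite distrC ger0_norm ?subr_ge0 1?ltW// distrC => tsd.
by apply: H => //; exact: ltW.
Qed.

Lemma abs_continuous_bounded (R : realType) (a b : R) (f : R -> R) :
  a <= b -> abs_continuous a b f ->
  exists2 M : R, 0 < M & forall t : R, a <= t <= b -> `|f t| <= M.
Proof.
move=> ab fac; apply: locally_bounded_itv => // x xab.
have [d d0 H] := abs_continuous_unif fac ltr01.
exists d => //; exists (`|f x| + 1) => t tab txd.
have := H x t xab tab txd; have := ler_normD (f t - f x) (f x).
by rewrite subrK; lra.
Qed.

Lemma lipschitz_abs_continuous (R : realType) (a b M : R) (f : R -> R) :
  0 < M ->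
  (forall s t : R, a <= s -> s <= t -> t <= b -> `|f t - f s| <= M * (t - s)) ->
  abs_continuous a b f.
Proof.
move=> M0 fM e e0; exists (e / M); first exact: divr_gt0.
move=> n u v uv _ suv.
apply: (@le_lt_trans _ _ (\sum_(i < n) M * (v i - u i))).
  by apply: ler_sum => i _; have [? ? ?] := uv i; exact: fM.
by rewrite -mulr_sumr mulrC -ltr_pdivlMr.
Qed.

Lemma abs_continuousD (R : realType) (a b : R) (f g : R -> R) :
  abs_continuous a b f -> abs_continuous a b g ->
  abs_continuous a b (fun x => f x + g x).
Proof.
move=> fac gac e e0.
have e20 : 0 < e / 2 by lra.
have [d1 d10 H1] := fac _ e20; have [d2 d20 H2] := gac _ e20.
exists (Num.min d1 d2); first by rewrite lt_min d10.
move=> n u v uv tr; rewrite lt_min => /andP[s1 s2].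
apply: (@le_lt_trans _ _ (\sum_(i < n) `|f (v i) - f (u i)| +
                         \sum_(i < n) `|g (v i) - g (u i)|)).
  rewrite -big_split/=; apply: ler_sum => i _.
  by rewrite opprD addrACA ler_normD.
by have := H1 n u v uv tr s1; have := H2 n u v uv tr s2; lra.
Qed.

Lemma abs_continuousM (R : realType) (a b : R) (f g : R -> R) :
  a <= b -> abs_continuous a b f -> abs_continuous a b g ->
  abs_continuous a b (fun x => f x * g x).
Proof.
move=> ab fac gac e e0.
have [M M0 fM] := abs_continuous_bounded ab fac.
have [N N0 gN] := abs_continuous_bounded ab gac.
(* The increment of the product is split as g(v) (f(v) - f(u)) + f(u) (g(v) - g(u)); with these
   tolerances each summand costs less than e / 2. *)
have eN0 : 0 < e / 2 / N by rewrite !divr_gt0.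
have eM0 : 0 < e / 2 / M by rewrite !divr_gt0.
have [d1 d10 H1] := fac _ eN0; have [d2 d20 H2] := gac _ eM0.
exists (Num.min d1 d2); first by rewrite lt_min d10.
move=> n u v uv tr; rewrite lt_min => /andP[s1 s2].
apply: (@le_lt_trans _ _ (\sum_(i < n) (N * `|f (v i) - f (u i)|) +
                         \sum_(i < n) (M * `|g (v i) - g (u i)|))).
  rewrite -big_split/=; apply: ler_sum => i _.
  have [au uvi vb] := uv i.
  have -> : f (v i) * g (v i) - f (u i) * g (u i) =
    g (v i) * (f (v i) - f (u i)) + f (u i) * (g (v i) - g (u i)) by ring.
  apply: (le_trans (ler_normD _ _)); rewrite !normrM lerD// ler_wpM2r//.
    by apply: gN; lra.
  by apply: fM; lra.
rewrite -!mulr_sumr.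
have := H1 n u v uv tr s1; have := H2 n u v uv tr s2.
rewrite -[e / 2 / M]mulrC -[e / 2 / N]mulrC !ltr_pdivlMl//.
by lra.
Qed.

(** * Functions with zero derivative almost everywhere *)

(** With the denominator cleared the estimate also holds at t = x, and increments on both sides of x
    can be added without dividing. *)
Lemma is_derive1_linear_approx (R : realType) (f : R -> R) (x l : R) :
  is_derive x 1 f l <-> forall e : R, 0 < e -> exists2 d : R, 0 < d &
    forall t : R, `|t - x| < d -> `|f t - f x - l * (t - x)| <= e * `|t - x|.
Proof.
split=> [[df <-] e e0|H].
- have /cvgrPdist_le/(_ _ e0) :
    h^-1 *: (f (h *: 1 + x) - f x) @[h --> 0^'] --> 'D_1 f x by exact: df.
  rewrite near_withinE => /nbhs_ballP[d /= d0 dP]; exists d => // t txd.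
  have [->|tx] := eqVneq t x; first by rewrite !subrr mulr0 subrr normr0 mulr0.
  have tx0 : t - x != 0 by rewrite subr_eq0.
  have := dP (t - x); rewrite /ball/= sub0r normrN => /(_ txd tx0).
  rewrite /GRing.scale/= mulr1 subrK => h.
  rewrite -ler_pdivrMr ?normr_gt0// -normf_div.
  apply: le_trans h; rewrite -normrN le_eqVlt; apply/orP; left; apply/eqP.
  by congr `|_|; field.
- have cv : h^-1 *: (f (h *: 1 + x) - f x) @[h --> 0^'] --> l.
    apply/cvgrPdist_le => e e0; have [d d0 dP] := H e e0.
    rewrite near_withinE; apply/nbhs_ballP; exists d => //= h.
    rewrite /ball/= sub0r normrN => hd h0.
    have := dP (h + x); rewrite addrK => /(_ hd).
    rewrite /GRing.scale/= mulr1 -ler_pdivrMr ?normr_gt0// -normf_div => hh.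
    apply: le_trans hh; rewrite -normrN le_eqVlt; apply/orP; left; apply/eqP.
    by congr `|_|; field.
  by split; [apply/cvg_ex; exists l|apply/cvg_lim].
Qed.

(** Lists ordered from left to right can be concatenated, as the interval induction requires; the
    order takes the place of the disjointness of a family indexed by ['I_n]. *)
Lemma abs_continuous_seq (R : realType) (a b : R) (f : R -> R) :
  abs_continuous a b f -> forall e : R, 0 < e -> exists2 d : R, 0 < d &
    forall l : seq (R * R),
      all (fun p => [&& a <= p.1, p.1 <= p.2 & p.2 <= b]) l ->
      pairwise (fun p q => p.2 <= q.1) l ->
      \sum_(p <- l) (p.2 - p.1) < d ->
      \sum_(p <- l) `|f p.2 - f p.1| < e.
Proof.
move=> fac e /fac[d d0 H]; exists d => // l /(all_nthP (0, 0)) lab.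
move=> /(pairwiseP (0, 0)) lpw.
rewrite !(big_nth (0, 0)) !big_mkord => ld.
apply: (H _ (fun i => (nth (0, 0) l i).1) (fun i => (nth (0, 0) l i).2)) => //.
  by move=> i; have /and3P[] := lab i (ltn_ord i).
move=> i j _ _ [z /= []]; rewrite !in_itv/= => /andP[iz zi] /andP[jz zj].
apply/val_inj; case: (ltngtP i j) => // ij; exfalso.
  by have /= := lpw i j (ltn_ord i) (ltn_ord j) ij; lra.
by have /= := lpw j i (ltn_ord j) (ltn_ord i) ij; lra.
Qed.

Lemma open_real_ball (R : realType) (U : set R) (x : R) :
  open U -> U x -> exists2 d : R, 0 < d & forall t : R, `|t - x| < d -> U t.
Proof.
move=> oU Ux; have /nbhs_ballP[d d0 dU] := open_nbhs_nbhs (conj oU Ux).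
by exists d => // t txd; apply: dU; rewrite /ball/= distrC.
Qed.

Lemma finite_set_negligible (R : realType) (A : set R) :
  finite_set A -> (@lebesgue_measure R).-negligible A.
Proof.
move=> /finite_set_countable cA; apply/negligibleP.
  by apply: countable_measurable => // t; exact: measurable_set1.
exact: countable_lebesgue_measure0.
Qed.

(** Outer regularity, applied to a measurable null set B containing A, bounds the measure of U minus
    B; adding the null set B back does not change it. *)
Lemma negligible_open_cover (R : realType) (A : set R) (d : R) :
  (@lebesgue_measure R).-negligible A -> 0 < d ->
  exists U : set R, [/\ open U, A `<=` U & (lebesgue_measure U < d%:E)%E].
Proof.
move=> [B [mB B0 AB]] d0.
have [|U [oU BU UB]] := @lebesgue_regularity_outer R B d mB _ d0.
  by rewrite [X in (X < _)%E]B0.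
exists U; split => //; first exact: subset_trans BU.
rewrite -(setDUK BU) measureU//.
- by rewrite [X in (X + _)%E]B0 add0e.
- by apply: measurableD => //; exact: measurable_realfun.open_measurable.
- by rewrite setDIK.
Qed.

(* Cousin's lemma: near a point with zero derivative the increment of f is at
   most e (t - s); the intervals tagged at the exceptional points lie in an
   open set of small measure, where absolute continuity applies. *)
Theorem abs_continuous_derive0_ae (R : realType) (a b : R) (f : R -> R)
    (N : set R) :
  a <= b -> abs_continuous a b f -> (@lebesgue_measure R).-negligible N ->
  (forall x : R, a < x < b -> ~ N x -> is_derive x 1 f 0) -> f b = f a.
Proof.
move=> ab fac N0 df.
suff H (e : R) : 0 < e -> `|f b - f a| <= e * (b - a) + e.
  apply/eqP; rewrite -subr_eq0 -normr_le0; apply/ler_addgt0Pl => e e0.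
  (* With c = e / (b - a + 1) the bound c (b - a) + c equals e. *)
  have ba : 0 < b - a + 1 by lra.
  have := H (e / (b - a + 1)) (divr_gt0 e0 ba).
  set c := e / _ => h; rewrite addr0 (le_trans h)//.
  rewrite -{2}[c]mulr1 -mulrDr divfK//; lra.
move=> e0; have [d d0 dP] := abs_continuous_seq fac e0.
(* The derivative is known only inside ]a, b[, so the end points join the exceptional set. *)
have N'0 : (@lebesgue_measure R).-negligible (N `|` [set a; b]).
  apply: negligibleU => //; exact: finite_set_negligible.
have [U [oU NU Ud]] := negligible_open_cover N'0 d0.
have mU : measurable U by exact: measurable_realfun.open_measurable.
(* Half-open intervals make [m] additive over adjacent intervals. *)
pose m s t := fine (lebesgue_measure (U `&` `]s, t])).
have mfin s t : lebesgue_measure (U `&` `]s, t]) \is a fin_num.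
  rewrite ge0_fin_numE//; apply: le_lt_trans (lt_trans Ud (ltry _)).
  by apply: le_measure; rewrite ?inE//; exact: measurableI.
(* The list [l] gathers the intervals tagged in [U]. Their total length is at most the measure of
   [U], hence below [d], and absolute continuity makes their increments sum to less than e. *)
suff [l [lab lpw lm lf]] : exists l : seq (R * R),
  [/\ all (fun p => [&& a <= p.1, p.1 <= p.2 & p.2 <= b]) l,
      pairwise (fun p q => p.2 <= q.1) l,
      \sum_(p <- l) (p.2 - p.1) <= m a b &
      `|f b - f a| <= e * (b - a) + \sum_(p <- l) `|f p.2 - f p.1|].
  apply: (le_trans lf); rewrite lerD2l ltW// dP// (le_lt_trans lm)//.
  rewrite -lte_fin fineK//; apply: le_lt_trans Ud.
  by apply: le_measure; rewrite ?inE//; exact: measurableI.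
apply: (@itv_additive_ind R a b (fun s t : R => exists l : seq (R * R),
  [/\ all (fun p => [&& s <= p.1, p.1 <= p.2 & p.2 <= t]) l,
      pairwise (fun p q => p.2 <= q.1) l,
      \sum_(p <- l) (p.2 - p.1) <= m s t &
      `|f t - f s| <= e * (t - s) + \sum_(p <- l) `|f p.2 - f p.1|])) => //.
- move=> s t u as_ st tu ub [l [lst lpw lm lf]] [k [ktu kpw km kf]].
  exists (l ++ k); split.
  + rewrite all_cat; apply/andP; split.
      by apply: sub_all lst => p /and3P[-> -> /= h]; exact: le_trans tu.
    by apply: sub_all ktu => p /and3P[/(le_trans st) -> -> ->].
  + rewrite pairwise_cat lpw kpw !andbT; apply/allrelP => p q /(allP lst).
    by move=> /and3P[_ _ pt] /(allP ktu)/and3P[tq _ _]; exact: le_trans tq.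
  + rewrite big_cat/=.
    suff -> : m s u = m s t + m t u by exact: lerD.
    rewrite /m -fineD//; congr fine.
    rewrite -measureU//; first last.
    * rewrite setIACA setIid; apply/seteqP; split=> // x /=.
      by rewrite !in_itv/= => -[_ [/andP[_ xt] /andP[tx _]]]; lra.
    * exact: measurableI.
    * exact: measurableI.
    rewrite -setIUr; congr (_ (_ `&` _)); apply/seteqP; split=> x /=;
      rewrite !in_itv/=.
      by move=> /andP[sx xu]; have [xt|tx] := leP x t; [left|right]; lra.
    by move=> [] /andP[]; lra.
  + rewrite big_cat/=.
    have := ler_normD (f u - f t) (f t - f s).
    rewrite addrA subrK.
    have -> : e * (u - s) = e * (u - t) + e * (t - s) by ring.
    by lra.
- move=> x /andP[ax xb].
  have [Ux|nUx] := pselect (U x).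
    have [g g0 gU] := open_real_ball oU Ux.
    exists g => // s t /andP[as_ sx] /andP[xt tb] xs tx.
    have stU (z : R) : s < z -> z <= t -> U z.
      by move=> sz zt; apply: gU; rewrite ltr_norml; lra.
    (* By [stU] all of ]s, t] lies in [U], so [m s t] is exactly t - s and pays for the interval. *)
    exists [:: (s, t)]; rewrite !big_seq1/=; split => //.
    + by rewrite !lexx (le_trans sx xt).
    + rewrite /m (_ : _ `&` _ = `]s, t]%classic).
        rewrite lebesgue_measure_itv/= lte_fin.
        by case: ltP => //= ts; lra.
      apply/seteqP; split=> [z [//]|z/= zst]; split=> //.
      by move: zst; rewrite in_itv/= => /andP[]; exact: stU.
    + by rewrite lerDr mulr_ge0 ?(ltW e0)//; lra.
  (* A point outside [U] is neither an end point nor in [N], and the empty list suffices. *)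
  have axb : a < x < b.
    by rewrite !lt_neqAle ax xb !andbT; apply/andP; split; apply/eqP => xE;
      apply: nUx; apply: NU; right; [left|right].
  have /is_derive1_linear_approx/(_ _ e0)[g g0 gP] := df x axb
    (fun Nx => nUx (NU _ (or_introl Nx))).
  exists g => // s t /andP[as_ sx] /andP[xt tb] xs tx.
  exists [::]; rewrite !big_nil; split => //; first exact: fine_ge0.
  rewrite addr0.
  have := gP s; rewrite mul0r subr0 => /(_ _)/[!ltr_norml].
  have := gP t; rewrite mul0r subr0 => /(_ _)/[!ltr_norml].
  rewrite [ `|s - x|]ler0_norm ?subr_le0// [ `|t - x|]ger0_norm ?subr_ge0//.
  move=> h1 h2; have {h1} h1 := h1 ltac:(lra); have {h2} h2 := h2 ltac:(lra).
  have := ler_normB (f t - f x) (f s - f x).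
  have -> : f t - f x - (f s - f x) = f t - f s by ring.
  have -> : e * (t - s) = e * (t - x) + e * - (s - x) by ring.
  by lra.
Qed.

(** * Derivatives relative to [a, b] *)

Lemma derivable_in_linear_approx (R : realType) (a b x : R) (f : R -> R) :
  derivable_in a b f x -> forall e : R, 0 < e -> exists2 d : R, 0 < d &
    forall t : R, a <= t <= b -> `|t - x| < d ->
      `|f t - f x - deriv_in a b f x * (t - x)| <= e * `|t - x|.
Proof.
move=> df e e0.
have /cvgrPdist_le/(_ _ e0) :
  diff_quot f x @ within `[a, b]%classic x^' --> deriv_in a b f x by exact: df.
rewrite !near_withinE => /nbhs_ballP[d /= d0 dP]; exists d => // t tab txd.
have [->|tx] := eqVneq t x; first by rewrite !subrr mulr0 subrr normr0 mulr0.
have tx0 : t - x != 0 by rewrite subr_eq0.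
have := dP t; rewrite /ball/= distrC in_itv/= => /(_ txd tx tab).
rewrite /diff_quot => h.
rewrite -ler_pdivrMr ?normr_gt0// -normf_div.
apply: le_trans h; rewrite -normrN le_eqVlt; apply/orP; left; apply/eqP.
by congr `|_|; field.
Qed.

Lemma derivable_in_is_derive (R : realType) (a b x : R) (f : R -> R) :
  a < x < b -> derivable_in a b f x -> is_derive x 1 f (deriv_in a b f x).
Proof.
move=> /andP[ax xb] df; apply/is_derive1_linear_approx => e e0.
have [d d0 dP] := derivable_in_linear_approx df e0.
exists (Num.min d (Num.min (x - a) (b - x))).
  by rewrite !lt_min d0 !subr_gt0 ax.
move=> t; rewrite !lt_min => /andP[td /andP[]].
by rewrite !ltr_norml => h1 h2; apply: dP => //; lra.
Qed.

(** The linear approximation with error 1 bounds increments from x by (M + 1) |t - x|, and the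
    interval induction adds these up. The extra 1 is harmless, since any Lipschitz constant gives
    absolute continuity. *)
Lemma deriv_in_bounded_lipschitz (R : realType) (a b M : R) (f : R -> R) :
  (forall x, a <= x <= b -> derivable_in a b f x) ->
  (forall x, a <= x <= b -> `|deriv_in a b f x| <= M) ->
  forall s t : R, a <= s -> s <= t -> t <= b ->
    `|f t - f s| <= (M + 1) * (t - s).
Proof.
move=> df dM s0 t0 as0 st0 tb0.
apply: (@itv_additive_ind R s0 t0
  (fun s t : R => `|f t - f s| <= (M + 1) * (t - s))) => //.
  move=> s t u _ _ _ _ h1 h2.
  have := ler_normD (f u - f t) (f t - f s); rewrite addrA subrK.
  have -> : (M + 1) * (u - s) = (M + 1) * (u - t) + (M + 1) * (t - s) by ring.
  by lra.
move=> x /andP[sx xt].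
have xab : a <= x <= b by lra.
have [d d0 dP] := derivable_in_linear_approx (df x xab) ltr01.
have H (z : R) : a <= z <= b -> `|z - x| < d ->
    `|f z - f x| <= (M + 1) * `|z - x|.
  move=> zab zx; have := dP z zab zx; have := dM x xab.
  have := ler_normD (f z - f x - deriv_in a b f x * (z - x))
                    (deriv_in a b f x * (z - x)).
  rewrite subrK normrM mulrDl => h1 h2 h3.
  have := ler_wpM2r (normr_ge0 (z - x)) h2; lra.
exists d => // s t /andP[s0s sx'] /andP[xt' tt0] xds txd.
have := H s; have := H t; rewrite !ltr_norml.
rewrite [ `|s - x|]ler0_norm ?subr_le0// [ `|t - x|]ger0_norm ?subr_ge0//.
move=> h1 h2.
have {h1} h1 := h1 ltac:(lra) ltac:(lra).
have {h2} h2 := h2 ltac:(lra) ltac:(lra).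
have := ler_normB (f t - f x) (f s - f x).
have -> : f t - f x - (f s - f x) = f t - f s by ring.
have -> : (M + 1) * (t - s) = (M + 1) * (t - x) + (M + 1) * - (s - x) by ring.
by lra.
Qed.

Lemma C1_abs_continuous (R : realType) (a b : R) (f : R -> R) :
  a <= b -> (forall x, a <= x <= b -> derivable_in a b f x) ->
  abs_continuous a b (deriv_in a b f) -> abs_continuous a b f.
Proof.
move=> ab df /(abs_continuous_bounded ab)[M M0 dM].
by apply: lipschitz_abs_continuous (deriv_in_bounded_lipschitz df dM); lra.
Qed.

(** Close to a, f(t) is nearly f'(a) (t - a). The product with the slope treats both signs at
    once. *)
Lemma deriv_in_left_sign (R : realType) (a b : R) (f : R -> R) :
  a < b -> derivable_in a b f a -> f a = 0 -> deriv_in a b f a != 0 ->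
  forall c : R, a < c -> exists2 s : R, a < s < c & 0 < f s * deriv_in a b f a.
Proof.
move=> ab df fa0 l0 c ac; set l := deriv_in a b f a in l0 *.
(* An error of half the slope leaves f(a + h) l >= l^2 h / 2. *)
have l20 : 0 < `|l| / 2 by rewrite divr_gt0// normr_gt0.
have [d d0 dP] := derivable_in_linear_approx df l20.
pose h := Num.min (d / 2) (Num.min ((c - a) / 2) (b - a)).
have [hd hc hb] : [/\ h <= d / 2, h <= (c - a) / 2 & h <= b - a].
  by rewrite /h !ge_min !lexx !orbT; split.
have h0 : 0 < h by rewrite /h !lt_min; lra.
exists (a + h); first by lra.
have := dP (a + h); rewrite [a + h - a]addrAC subrr add0r -/l fa0 subr0.
rewrite gtr0_norm// => H.
have {}H := H ltac:(lra) ltac:(lra).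
have := ler_wpM2r (normr_ge0 l) H; rewrite -normrM ler_norml => /andP[+ _].
have -> : `|l| / 2 * h * `|l| = l ^+ 2 * h / 2.
  by rewrite -(real_normK (num_real l)); field.
have : 0 < l ^+ 2 * h by rewrite mulr_gt0// exprn_even_gt0.
have -> : (f (a + h) - l * h) * l = f (a + h) * l - l ^+ 2 * h by ring.
by lra.
Qed.

(** * Piecewise continuous functions and primitives of bounded functions *)

(** The one-sided limits bound f on either side of each point; the arbitrary value at the point
    itself enters the maximum. *)
Lemma piecewise_continuous_bounded (R : realType) (a b : R) (f : R -> R) :
  a <= b -> piecewise_continuous a b f ->
  exists2 M : R, 0 < M & forall t : R, a <= t <= b -> `|f t| <= M.
Proof.
move=> ab [_ [_ fr fl]]; apply: locally_bounded_itv => // x /andP[ax xb].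
have [d1 [M1 [d10 H1]]] : exists d M : R,
    0 < d /\ forall t : R, x < t -> t <= b -> t < x + d -> `|f t| <= M.
  (* At b there is nothing on the right, so any witnesses serve. *)
  have [bx|xb'] := leP b x; first by exists 1, 0; split=> // t; lra.
  have xab : x \in `[a, b[ by rewrite in_itv/= ax.
  have /cvgrPdist_le/(_ _ ltr01) := fr x xab.
  rewrite near_withinE => /nbhs_ballP[d /= d0 dP].
  exists d, (`|lim (f @ x^'+)| + 1).
  split=> // t xt _ txd.
  have := dP t; rewrite /ball/= distrC gtr0_norm ?subr_gt0//.
  move=> /(_ ltac:(lra) xt); rewrite distrC => h.
  have := ler_normD (f t - lim (f @ x^'+)) (lim (f @ x^'+)); rewrite subrK.
  by lra.
have [d2 [M2 [d20 H2]]] : exists d M : R,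
    0 < d /\ forall t : R, t < x -> a <= t -> x - d < t -> `|f t| <= M.
  have [xa|ax'] := leP x a; first by exists 1, 0; split=> // t; lra.
  have xab : x \in `]a, b] by rewrite in_itv/= ax'.
  have /cvgrPdist_le/(_ _ ltr01) := fl x xab.
  rewrite near_withinE => /nbhs_ballP[d /= d0 dP].
  exists d, (`|lim (f @ x^'-)| + 1).
  split=> // t xt _ txd; have := dP t; rewrite /ball/= gtr0_norm ?subr_gt0//.
  move=> /(_ ltac:(lra) xt); rewrite distrC => h.
  have := ler_normD (f t - lim (f @ x^'-)) (lim (f @ x^'-)); rewrite subrK.
  by lra.
exists (Num.min d1 d2); first by rewrite lt_min d10.
exists (Num.max `|f x| (Num.max M1 M2)) => t /andP[at_ tb].
rewrite lt_min !ltr_norml => /andP[h1 h2]; rewrite !le_max; apply/orP.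
case: (ltgtP t x) => [tx|xt|->]; [right|right|by left]; apply/orP.
  by right; apply: H2 => //; lra.
by left; apply: H1 => //; lra.
Qed.

(** [a, b] is covered by an open set on which f is continuous and a finite set all of whose subsets
    are measurable. *)
Lemma continuous_off_seq_measurable (R : realType) (a b : R) (s : seq R)
    (f : R -> R) :
  (forall x, a < x < b -> x \notin s -> {for x, continuous f}) ->
  measurable_fun `[a, b]%classic f.
Proof.
move=> fc; pose O := `]a, b[%classic `\` [set` s].
pose S := [set` a :: b :: s].
have fS : finite_set S by exact: finite_seq.
have mS (A : set R) : A `<=` S -> measurable A.
  move=> AS; apply: countable_measurable => [t|]; first exact: measurable_set1.
  exact/finite_set_countable/(sub_finite_set AS).
have oO : open O.
  apply: openI; first exact: interval_open.
  rewrite openC; apply: (accessible_finite_set_closed.1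
    (hausdorff_accessible (@Rhausdorff R))).
  exact: finite_seq.
have mO : measurable O by exact: measurable_realfun.open_measurable.
apply: (@measurable_funS _ _ _ _ (O `|` S)).
- by apply: measurableU => //; exact: mS.
- move=> x; rewrite /= in_itv/= => /andP[ax xb].
  have [xS|xS] := boolP (x \in a :: b :: s); first by right.
  left; move: xS; rewrite !inE !negb_or => /and3P[xa xb' xs]; split.
    by rewrite /= in_itv/= !lt_neqAle ax xb xb' eq_sym xa.
  by apply/negP.
- apply/measurable_funU => //; first exact: mS.
  split.
    apply: measurable_realfun.open_continuous_measurable_fun => // x.
    rewrite inE => -[/=].
    by rewrite in_itv/= => xab /negP; exact: fc.
  by move=> mS' Y mY; apply: mS; exact: subIsetl.
Qed.

Lemma bounded_itv_integrable (R : realType) (a b M : R) (g : R -> R) :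
  measurable_fun `[a, b]%classic g ->
  (forall t : R, a <= t <= b -> `|g t| <= M) ->
  (@lebesgue_measure R).-integrable `[a, b]%classic (EFin \o g).
Proof.
move=> mg gM; apply: measurable_bounded_integrable => //.
  by rewrite /= lebesgue_measure_itv/=; case: ifP => _; rewrite -?EFinB ltry.
exists M; split; first exact: num_real.
move=> N MN t /=; rewrite in_itv/= => /gM h; exact: le_trans (ltW MN).
Qed.

Section bounded_primitive.
Variables (R : realType) (a b M : R) (g : R -> R).
Hypothesis mg : measurable_fun `[a, b]%classic g.
Hypothesis gM : forall t : R, a <= t <= b -> `|g t| <= M.

Let mu := @lebesgue_measure R.

Lemma bounded_primitive_abs_continuous :
  0 < M -> abs_continuous a b (fun x => \int[mu]_(t in `[a, x]) g t).
Proof.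
move=> M0; apply: (lipschitz_abs_continuous M0) => s t as_ st tb.
have ints (c d : R) : a <= c -> d <= b ->
    mu.-integrable `[c, d]%classic (EFin \o g).
  move=> ac db; apply: integrableS (bounded_itv_integrable mg gM) => //.
  by apply: subset_itv; rewrite bnd_simp.
rewrite Rintegral_itvB; [|exact: ints|by rewrite bnd_simp|by rewrite bnd_simp].
rewrite Rintegral_itv_obnd_cbnd; last first.
  apply: integrableS (ints s t as_ tb) => //.
  exact: subset_itv_oc_cc.
apply: (le_trans (le_normr_Rintegral _ _)) => //; first exact: ints.
have -> : M * (t - s) = \int[mu]_(x in `[s, t]) M.
  rewrite Rintegral_cst//= lebesgue_measure_itv/= lte_fin.
  by case: ltP => //= ts; congr (_ * _); lra.
apply: le_Rintegral => //.
- exact/integrable_norm/ints.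
- by apply: (@bounded_itv_integrable _ s t M) => // x _; rewrite gtr0_norm.
- by move=> x /=; rewrite in_itv/= => /andP[sx xt]; apply: gM; lra.
Qed.

Lemma bounded_primitive_is_derive (x : R) :
  a < x < b -> {for x, continuous g} ->
  is_derive x 1 (fun x => \int[mu]_(t in `[a, x]) g t) (g x).
Proof.
move=> /andP[ax xb] gx.
have [|dF Fx] := @continuous_FTC1 R g (BLeft a) x b xb
  (bounded_itv_integrable mg gM) _ gx.
  by rewrite /= lte_fin.
by split=> //; rewrite -derive1E.
Qed.

End bounded_primitive.

(** * The Wronskian identity *)

Lemma abs_continuous_cst (R : realType) (a b c : R) :
  abs_continuous a b (fun=> c).
Proof.
apply: (@lipschitz_abs_continuous R a b 1) => // s t _ st _.
by rewrite subrr normr0 mul1r subr_ge0.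
Qed.

Lemma sqmodE (R : realType) (y : R -> R[i]) (x : R) :
  sqmod (y x) = re_part y x ^+ 2 + im_part y x ^+ 2.
Proof.
rewrite /sqmod /re_part /im_part; case: (y x) => p s /=.
by rewrite sqr_sqrtr// addr_ge0// sqr_ge0.
Qed.

(** Here w stands for y''. Splitting the equation into real and imaginary parts, the terms with q
    and with Re(lam) cancel in the combination on the left. *)
Lemma sl_equation_wronskian (R : realType) (lam z w : R[i]) (q r : R) :
  - w + q%:C%C * z = lam * r%:C%C * z ->
  complex.Re z * complex.Im w - complex.Re w * complex.Im z =
  - complex.Im lam * (r * (complex.Re z ^+ 2 + complex.Im z ^+ 2)).
Proof.
case: lam z w => [al be] [p s] [w1 w2] /eqP; rewrite eq_complex /=.
move=> /andP[/eqP e1 /eqP e2].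
have -> : w1 = q * p - r * (al * p - be * s) by lra.
have -> : w2 = q * s - r * (al * s + be * p) by lra.
by ring.
Qed.

(* The Wronskian of the real and imaginary parts vanishes at a and has almost
   everywhere the derivative - Im(lam) r |y|^2. *)
Lemma sl_solution_wronskian (R : realType) (a b : R) (q r : R -> R)
    (lam : R[i]) (y : R -> R[i]) (x : R) :
  a < b -> piecewise_continuous a b r -> sl_solution a b q r lam y -> y a = 0 ->
  a < x < b ->
  re_part y x * deriv_in a b (im_part y) x
    - deriv_in a b (re_part y) x * im_part y x =
  - complex.Im lam *
    \int[lebesgue_measure]_(t in `[a, x]) (r t * sqmod (y t)).
Proof.
move=> ab rpc [[dy acp acs] yeq] ya0 /andP[ax xb].
set phi := re_part y; set psi := im_part y.
set dphi := deriv_in a b phi; set dpsi := deriv_in a b psi.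
set be := complex.Im lam.
have ab' := ltW ab.
have dphiP t : a <= t <= b -> derivable_in a b phi t.
  by move=> tab; have [] : cderivable_in a b y t by apply: dy; rewrite in_itv.
have dpsiP t : a <= t <= b -> derivable_in a b psi t.
  by move=> tab; have [] : cderivable_in a b y t by apply: dy; rewrite in_itv.
have ac_dphi : abs_continuous a b dphi by exact: acp.
have ac_dpsi : abs_continuous a b dpsi by exact: acs.
have ac_phi := C1_abs_continuous ab' dphiP ac_dphi.
have ac_psi := C1_abs_continuous ab' dpsiP ac_dpsi.
pose g := fun t : R => r t * sqmod (y t).
have gE t : g t = r t * (phi t ^+ 2 + psi t ^+ 2) by rewrite /g sqmodE.
have [s [rc _ _]] := rpc.
have gc t : a < t < b -> t \notin s -> {for t, continuous g}.
  move=> tab ts; rewrite (_ : g = (fun t => r t * (phi t ^+ 2 + psi t ^+ 2))).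
    have dphit := derivable_in_is_derive tab (dphiP t ltac:(lra)).
    have dpsit := derivable_in_is_derive tab (dpsiP t ltac:(lra)).
    apply: cvgM; first by apply: rc; rewrite ?in_itv.
    apply: cvgD; apply: cvgM;
      by apply/differentiable_continuous/derivable1_diffP; exact: ex_derive.
  by apply/funext => u.
have mg := continuous_off_seq_measurable gc.
have [M M0 gM] :
    exists2 M : R, 0 < M & forall t : R, a <= t <= b -> `|g t| <= M.
  have [Mr Mr0 rM] := piecewise_continuous_bounded ab' rpc.
  have [Mp Mp0 pM] := abs_continuous_bounded ab' ac_phi.
  have [Ms Ms0 sM] := abs_continuous_bounded ab' ac_psi.
  exists (Mr * (Mp ^+ 2 + Ms ^+ 2)) => [|t tab].
    by rewrite mulr_gt0// addr_gt0// exprn_gt0.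
  rewrite gE normrM ler_pM// ?rM//.
  rewrite (le_trans (ler_normD _ _))// !normrX lerD// ler_sqr ?nnegrE ?pM ?sM//;
    exact: ltW.
pose G := fun t : R => \int[lebesgue_measure]_(u in `[a, t]) g u.
have ac_G : abs_continuous a b G := bounded_primitive_abs_continuous mg gM M0.
(* The claim is F = 0 at x: F is absolutely continuous, its derivative vanishes off a null set, and
   it is zero at a. *)
pose F := (phi * dpsi - dphi * psi) + be \*: G.
have ac_F : abs_continuous a b F.
  have ac_wr := abs_continuousD (abs_continuousM ab' ac_phi ac_dpsi)
    (abs_continuousM ab' (@abs_continuous_cst R a b (-1))
      (abs_continuousM ab' ac_dphi ac_psi)).
  have ac_beG := abs_continuousM ab' (@abs_continuous_cst R a b be) ac_G.
  have := abs_continuousD ac_wr ac_beG.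
  rewrite (_ : (fun t => _) = F)//; apply/funext => t.
  by rewrite /F /= mulN1r.
(* The null set consists of the points where the equation fails and the listed exceptional points of
   [r], where the primitive [G] may lack a derivative. *)
have N0 := negligibleU yeq (finite_set_negligible (finite_seq s)).
have FxFa : F x = F a.
  apply: (abs_continuous_derive0_ae (ltW ax)) N0 _.
    by apply: abs_continuousS ac_F => //; exact: ltW.
  move=> t /andP[at_ tx] /not_orP[/contrapT tN /negP ts].
  have tab : a < t < b by lra.
  have [[/(derivable_in_is_derive tab) ddphi
         /(derivable_in_is_derive tab) ddpsi] eq] := tN ltac:(rewrite in_itv/=; lra).
  have dphit := derivable_in_is_derive tab (dphiP t ltac:(lra)).
  have dpsit := derivable_in_is_derive tab (dpsiP t ltac:(lra)).
  have dG := bounded_primitive_is_derive mg gM tab (gc t tab ts).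
  apply: is_derive_eq; rewrite /GRing.scale/= gE.
  (* In F' the products of first derivatives cancel, leaving phi psi'' - phi'' psi + be g. *)
  have wr : phi t * deriv_in a b (im_part (cderiv_in a b y)) t -
    deriv_in a b (re_part (cderiv_in a b y)) t * psi t =
    - be * (r t * (phi t ^+ 2 + psi t ^+ 2)) := sl_equation_wronskian eq.
  by rewrite -/dphi -/dpsi; lra.
move: FxFa; rewrite /F /=.
have [phia psia] : phi a = 0 /\ psi a = 0.
  by rewrite /phi /psi /re_part /im_part ya0.
have Ga : G a = 0 by rewrite /G set_itv1 Rintegral_set1.
have addE (f h : R -> R) u : (f + h) u = f u + h u by [].
have oppE (f : R -> R) u : (- f) u = - f u by [].
have mulE (f h : R -> R) u : (f * h) u = f u * h u by [].
have scaleE (k : R) (f : R -> R) u : (k \*: f) u = k * f u by [].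
rewrite !(addE, oppE, mulE, scaleE) phia psia Ga mul0r !mulr0 subrr addr0.
move=> /eqP; rewrite addr_eq0 mulNr => /eqP ->.
by [].
Qed.

(** * Sign changes under a positive Wronskian *)

Lemma derivable_zero_between (R : realType) (h dh : R -> R) (s t : R) :
  s <= t -> (forall x, s <= x <= t -> is_derive x 1 h (dh x)) ->
  h s * h t <= 0 -> exists2 c, s <= c <= t & h c = 0.
Proof.
move=> st hd hst.
have [||c] := @IVT R h s t 0 st.
- apply: derivable_within_continuous => x; rewrite in_itv/= => xst.
  by have hx := hd x xst; exact: ex_derive.
- move: hst; rewrite ge_min le_max.
  case: (ltrgt0P (h s)) => hs; case: (ltrgt0P (h t)) => ht //=.
    by rewrite leNgt mulr_gt0.
  by rewrite leNgt nmulr_lgt0// hs.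
by rewrite in_itv/= => cst hc; exists c.
Qed.

(** The slopes at a enter only through signs taken arbitrarily close to a. This form fits both the
    pair (phi, psi) and, when phi'(a) < 0, the pair (-phi, -psi). *)
Lemma positive_wronskian (R : realType) (a b x0 : R) (f g df dg : R -> R) :
  a < x0 -> x0 < b ->
  (forall x, a < x < b -> is_derive x 1 f (df x)) ->
  (forall x, a < x < b -> is_derive x 1 g (dg x)) ->
  (forall x, a < x < b -> 0 < f x * dg x - df x * g x) ->
  (forall c, a < c -> exists2 s : R, a < s < c & 0 < f s) ->
  f x0 = 0 -> (forall x, a < x < x0 -> f x != 0) ->
  [/\ (forall c, a < c -> exists2 s : R, a < s < c & 0 < g s) ->
        forall x, x \in `]a, x0] -> 0 < g x,
      (exists2 s : R, a < s < x0 & g s < 0) -> vanishes_exactly_once a x0 g &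
      (forall x, x \in `]a, x0] -> 0 < g x) \/ vanishes_exactly_once a x0 g].
Proof.
move=> ax0 x0b fd gd wr_gt0 f_a f_x0 f_neq0.
have f_gt0 (x : R) : a < x < x0 -> 0 < f x.
  move=> /andP[ax xx0]; rewrite lt_neqAle eq_sym f_neq0 ?ax//= leNgt.
  apply/negP => fx; have [s sx fs] := f_a x ax.
  have [||| c cs fc] := @derivable_zero_between R f df s x.
  - lra.
  - by move=> z zs; apply: fd; lra.
  - by rewrite mulr_ge0_le0// ltW.
  have := f_neq0 c; rewrite fc eqxx => h.
  by have := h ltac:(lra).
have df_x0 : df x0 <= 0.
  rewrite leNgt; apply/negP => d0.
  (* A positive slope at x0 would give f(x0 - h) <= - f'(x0) h / 2 < 0 for small h, against
     [f_gt0]. *)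
  have d20 : 0 < df x0 / 2 by lra.
  have dfx0 : is_derive x0 1 f (df x0) by apply: fd; lra.
  have [d d'0 dP] := (is_derive1_linear_approx _ _ _).1 dfx0 _ d20.
  pose h := Num.min (d / 2) ((x0 - a) / 2).
  have [hd hx] : h <= d / 2 /\ h <= (x0 - a) / 2.
    by rewrite /h !ge_min !lexx !orbT.
  have h0 : 0 < h by rewrite /h !lt_min; lra.
  have := dP (x0 - h).
  rewrite [x0 - h - x0]addrAC subrr add0r normrN gtr0_norm// f_x0.
  rewrite subr0 ler_norml => H; have /andP[_] := H ltac:(lra).
  have := f_gt0 (x0 - h) ltac:(lra).
  have := mulr_gt0 d0 h0; lra.
have g_x0 : 0 < g x0.
  have := wr_gt0 x0; rewrite f_x0 mul0r sub0r -mulNr => H.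
  have {}H := H ltac:(lra).
  have dN0 : 0 < - df x0.
    rewrite oppr_gt0 lt_neqAle df_x0 andbT; apply/eqP => E.
    by move: H; rewrite E oppr0 mul0r ltxx.
  by move: H; rewrite pmulr_rgt0.
(* since g / f increases on ]a, x0[ *)
have g_propagates (s t : R) :
    a < s -> s < t -> t <= x0 -> 0 <= g s -> 0 < g t.
  (* At t = x0 the quotient is undefined and [g_x0] takes over. *)
  move=> as_ st; rewrite le_eqVlt => /predU1P[-> //|tx0] gs.
  have quot x : s <= x <= t -> is_derive x 1 (g * (fun z => (f z)^-1))
      ((f x) ^- 2 * (f x * dg x - df x * g x)).
    move=> xst.
    have fx : f x != 0 by apply: f_neq0; lra.
    have dfx : is_derive x 1 f (df x) by apply: fd; lra.
    have dgx : is_derive x 1 g (dg x) by apply: gd; lra.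
    have dVx := is_deriveV fx dfx.
    by apply: is_derive_eq; rewrite /GRing.scale/=; field.
  have [||c cst E] := @MVT R (g * (fun z => (f z)^-1))
    (fun x => (f x) ^- 2 * (f x * dg x - df x * g x)) s t st.
  - by move=> x; rewrite in_itv/= => xst; apply: quot; lra.
  - apply: derivable_within_continuous => x; rewrite in_itv/= => xst.
    by have hx := quot x xst; exact: ex_derive.
  move: cst; rewrite in_itv/= => cst.
  have fs := f_gt0 s ltac:(lra); have ft := f_gt0 t ltac:(lra).
  have fc := f_gt0 c ltac:(lra); have wc := wr_gt0 c ltac:(lra).
  have gfs : 0 <= g s / f s by rewrite divr_ge0// ltW.
  have mulE u : (g * (fun z => (f z)^-1)) u = g u / f u by [].
  rewrite !mulE in E.
  have : 0 < g t / f t.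
    have : 0 < f c ^- 2 * (f c * dg c - df c * g c) * (t - s).
      rewrite mulr_gt0//; last by rewrite subr_gt0.
      by rewrite mulr_gt0// invr_gt0 exprn_gt0.
    by lra.
  by rewrite pmulr_lgt0 ?invr_gt0.
(* Of two zeros, the earlier would force g > 0 at the later. *)
have zero_once (c : R) : a < c < x0 -> g c = 0 -> vanishes_exactly_once a x0 g.
  move=> /andP[ac cx0] gc; exists c; split; first by rewrite ac.
  move=> c' [/andP[ac' c'x0] gc']; case: (ltgtP c c') => // cc'; exfalso.
    have := g_propagates c c' ac cc' (ltW c'x0).
    by rewrite gc gc' lexx ltxx => /(_ isT).
  have := g_propagates c' c ac' cc' (ltW cx0).
  by rewrite gc gc' lexx ltxx => /(_ isT).
have zero_ex : (exists2 s : R, a < s < x0 & g s < 0) ->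
    vanishes_exactly_once a x0 g.
  move=> [s sx gs].
  have [||| c cs gc] := @derivable_zero_between R g dg s x0.
  - lra.
  - by move=> z zs; apply: gd; lra.
  - by rewrite mulr_le0_ge0// ltW.
  apply: (zero_once c) => //.
  have : c != x0 by apply/eqP => E; move: g_x0; rewrite -E gc ltxx.
  by rewrite neq_lt => /orP[]; lra.
split=> //.
  move=> g_a x; rewrite in_itv/= => /andP[ax xx0].
  have [s /andP[as_ sx] gs] := g_a x ax.
  by apply: (g_propagates s x as_ sx xx0); exact: ltW.
(* Without a sign near a: either g > 0 throughout, or some point has g <= 0 and is itself a zero or
   precedes one. *)
have [[s sx gs]|ng] := pselect (exists2 s : R, a < s < x0 & g s <= 0).
  right; case: (ltrgtP (g s) 0) => gs0; last exact: zero_once gs0.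
    by apply: zero_ex; exists s.
  by move: gs; rewrite leNgt gs0.
left=> x; rewrite in_itv/= => /andP[ax].
rewrite le_eqVlt => /predU1P[-> //|xx0].
by rewrite ltNge; apply/negP => gx; apply: ng; exists x; rewrite ?ax.
Qed.

(** * Application to the complex ghost *)

Lemma vanishes_exactly_onceN (R : realType) (a b : R) (f : R -> R) :
  vanishes_exactly_once a b (- f) -> vanishes_exactly_once a b f.
Proof.
have NE x : (- f) x = - f x by [].
move=> [c [[cab /eqP]]]; rewrite NE oppr_eq0 => /eqP fc uc.
by exists c; split=> // c' [c'ab fc']; apply: uc; rewrite NE fc' oppr0.
Qed.

Theorem lemma6 (R : realType) (a b : R) (q r : R -> R) (lam : R[i])
    (y : R -> R[i]) (x0 : R) :
  let phi := re_part y in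
  let psi := im_part y in
  let dphi := deriv_in a b phi in
  let dpsi := deriv_in a b psi in
  let G := fun x : R =>
    \int[lebesgue_measure]_(t in `[a, x]) (r t * sqmod (y t)) in
  a < b ->
  piecewise_continuous a b q ->
  piecewise_continuous a b r ->
  non_definite a b q r ->
  complex_ghost a b q r lam y ->
  0 < complex.Im lam ->
  (forall x, x \in `]a, b[ -> G x < 0) ->
  smallest_zero a b phi x0 ->
  (0 < dphi a ->
    [/\ 0 < dpsi a -> forall x, x \in `]a, x0] -> 0 < psi x,
        dpsi a < 0 -> vanishes_exactly_once a x0 psi &
        dpsi a = 0 ->
          (forall x, x \in `]a, x0] -> 0 < psi x) \/
          vanishes_exactly_once a x0 psi]) /\
  (dphi a < 0 ->
    [/\ dpsi a < 0 -> forall x, x \in `]a, x0] -> psi x < 0,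
        0 < dpsi a -> vanishes_exactly_once a x0 psi &
        dpsi a = 0 ->
          (forall x, x \in `]a, x0] -> psi x < 0) \/
          vanishes_exactly_once a x0 psi]).
Proof.
move=> phi psi dphi dpsi G ab _ rpc _ [[sol ya0 _ _] _] lam_gt0 G_lt0.
move=> [x0ab phix0 x0_min].
have /andP[ax0 x0b] : a < x0 < b by move: x0ab; rewrite in_itv.
have [[dy _ _] _] := sol.
have der t : a <= t <= b -> cderivable_in a b y t.
  by move=> tab; apply: dy; rewrite in_itv.
have phid x : a < x < b -> is_derive x 1 phi (dphi x).
  by move=> xab; apply: derivable_in_is_derive => //; have [] := der x ltac:(lra).
have psid x : a < x < b -> is_derive x 1 psi (dpsi x).
  by move=> xab; apply: derivable_in_is_derive => //; have [] := der x ltac:(lra).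
have wr x : a < x < b -> 0 < phi x * dpsi x - dphi x * psi x.
  move=> xab; rewrite (sl_solution_wronskian ab rpc sol ya0 xab).
  by rewrite mulNr oppr_gt0 pmulr_rlt0// G_lt0// in_itv.
have phi_neq0 x : a < x < x0 -> phi x != 0.
  move=> xax0; apply/eqP => phix.
  by have := x0_min x ltac:(rewrite in_itv/=; lra) phix; lra.
have [phia psia] : phi a = 0 /\ psi a = 0.
  by rewrite /phi /psi /re_part /im_part ya0.
have [dphia dpsia] : derivable_in a b phi a /\ derivable_in a b psi a.
  by apply: der; rewrite lexx ltW.
have phi_sign := deriv_in_left_sign ab dphia phia; rewrite -/dphi in phi_sign.
have psi_sign := deriv_in_left_sign ab dpsia psia; rewrite -/dpsi in psi_sign.
have psi_pos : 0 < dpsi a ->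
    forall c, a < c -> exists2 s : R, a < s < c & 0 < psi s.
  move=> d0 c ac; have [s asc h] := psi_sign (lt0r_neq0 d0) c ac.
  by exists s; rewrite // -(pmulr_lgt0 _ d0).
have psi_neg : dpsi a < 0 ->
    forall c, a < c -> exists2 s : R, a < s < c & psi s < 0.
  move=> d0 c ac; have [s asc h] := psi_sign (ltr0_neq0 d0) c ac.
  by exists s; rewrite // -(nmulr_lgt0 _ d0).
split=> dphi0.
  have [|p1 p2 p3] := positive_wronskian ax0 x0b phid psid wr _ phix0 phi_neq0.
    move=> c ac; have [s asc h] := phi_sign (lt0r_neq0 dphi0) c ac.
    by exists s; rewrite // -(pmulr_lgt0 _ dphi0).
  split=> [/psi_pos//|/psi_neg d0|_//]; exact/p2/d0.
have NE (h : R -> R) x : (- h) x = - h x by [].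
(* Changing both signs leaves the Wronskian unchanged and makes the first function positive near
   a. *)
have [||||||p1 p2 p3] := @positive_wronskian R a b x0 (- phi) (- psi)
    (- dphi) (- dpsi) ax0 x0b.
- by move=> x xab; have := phid x xab => ?; exact: is_deriveN.
- by move=> x xab; have := psid x xab => ?; exact: is_deriveN.
- by move=> x xab; rewrite !NE !mulrNN; exact: wr.
- move=> c ac; have [s asc h] := phi_sign (ltr0_neq0 dphi0) c ac.
  by exists s; rewrite // NE oppr_gt0 -(nmulr_lgt0 _ dphi0).
- by rewrite NE phix0 oppr0.
- by move=> x xax0; rewrite NE oppr_eq0; exact: phi_neq0.
split=> [d0 x xax0|d0|_].
- rewrite -oppr_gt0; apply: p1 => // c /(psi_neg d0)[s asc h].
  by exists s; rewrite // NE oppr_gt0.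
- apply/vanishes_exactly_onceN/p2.
  by have [s asc h] := psi_pos d0 x0 ax0; exists s; rewrite // NE oppr_lt0.
- case: p3 => [p|p]; [left|right; exact: vanishes_exactly_onceN].
  by move=> x /p; rewrite NE oppr_gt0.
Qed.
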